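(* For any dimension $d\in\mathbb{N}$, there exists $\varepsilon>0$ (depending only on $d$) such that every unital quantum channel $\tau$ on $\mathbb{M}_d$ satisfying $\|\tau-\delta_d\|<\varepsilon$ is a mixed twisted dephasing channel.
   Context: $\mathbb{M}_d$ is the algebra of $d\times d$ complex matrices and $\mathbb{U}(d)$ its unitary group. A quantum channel on $\mathbb{M}_d$ is a completely positive, trace-preserving linear map. $\delta_d(X)=\frac{\mathrm{Tr}(X)}{d}I_d$ is the completely depolarizing channel. $\|\cdot\|$ is a fixed norm on the finite-dimensional space of linear maps on $\mathbb{M}_d$ (all such norms being equivalent, the choice is immaterial). $\mathrm{Ad}_U(X)=UXU^*$; $\Delta_d(X)=\sum_{j=1}^d\langle e_j,Xe_j\rangle|e_j\rangle\langle e_j|$ with $\{e_j\}$ the standard basis of $\mathbb{C}^d$; for $U,V\in\mathbb{U}(d)$, $\beta_{U,V}=\mathrm{Ad}_U\circ\Delta_d\circ\mathrm{Ad}_{V^*}$. A mixed twisted dephasing channel is a finite convex combination of maps $\beta_{U,V}$, $U,V\in\mathbb{U}(d)$. *)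

(* Defs.v *)
From HB Require Import structures.
From mathcomp Require Import all_boot all_order all_algebra.
From mathcomp Require Import reals.
From mathcomp Require Import complex.

Set Implicit Arguments.
Unset Strict Implicit.
Unset Printing Implicit Defensive.

Import Order.TTheory GRing.Theory Num.Theory.

Local Open Scope ring_scope.
Local Open Scope sesquilinear_scope.

(* In the order of R[i], 0 <= z means that z is real and nonnegative, so a
   positive semidefinite matrix in this sense is automatically Hermitian. *)
Definition psdmx (R : realType) (n : nat) (A : 'M[R[i]]_n) : Prop :=
  forall v : 'cV[R[i]]_n, 0 <= (v^t* *m A *m v) 0 0.

(* The ampliation id_n (x) f on M_n (x) M_d, the latter being identified with
   the n x n block matrices whose blocks are d x d matrices. *)
Definition ampliation (R : realType) (d n : nat) (f : 'End('M[R[i]]_d))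
    (A : 'M[R[i]]_(\sum_(i < n) d)) : 'M[R[i]]_(\sum_(i < n) d) :=
  \mxblock_(i < n, j < n) f (submxblock A i j).

Definition completely_positive (R : realType) (d : nat)
    (f : 'End('M[R[i]]_d)) : Prop :=
  forall (n : nat) (A : 'M[R[i]]_(\sum_(i < n) d)),
    psdmx A -> psdmx (ampliation f A).

Definition trace_preserving (R : realType) (d : nat)
    (f : 'End('M[R[i]]_d)) : Prop :=
  forall X : 'M[R[i]]_d, \tr (f X) = \tr X.

Definition quantum_channel (R : realType) (d : nat)
    (f : 'End('M[R[i]]_d)) : Prop :=
  completely_positive f /\ trace_preserving f.

Definition unital (R : realType) (d : nat) (f : 'End('M[R[i]]_d)) : Prop :=
  f 1%:M = 1%:M.

Section Superoperators.
Variables (R : realType) (d : nat).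
Local Notation C := (R[i]).
Local Notation M := 'M[C]_d.

Definition depolarizing_fun (X : M) : M := (\tr X / d%:R)%:M.

Fact depolarizing_fun_is_linear : linear depolarizing_fun.
Proof.
move=> a X Y; rewrite /depolarizing_fun mxtraceD mxtraceZ mulrDl -mulrA.
by rewrite raddfD /= scale_scalar_mx.
Qed.

HB.instance Definition _ :=
  GRing.isLinear.Build C M M *:%R depolarizing_fun depolarizing_fun_is_linear.

Definition depolarizing : 'End(M) := linfun depolarizing_fun.

Lemma depolarizingE X : depolarizing X = (\tr X / d%:R)%:M.
Proof. exact: lfunE. Qed.

Definition Ad_fun (U X : M) : M := U *m X *m U^t*.

Fact Ad_fun_is_linear U : linear (Ad_fun U).
Proof.
by move=> a X Y; rewrite /Ad_fun mulmxDr mulmxDl -scalemxAr -scalemxAl.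
Qed.

HB.instance Definition _ U :=
  GRing.isLinear.Build C M M *:%R (Ad_fun U) (Ad_fun_is_linear U).

Definition Ad (U : M) : 'End(M) := linfun (Ad_fun U).

Lemma AdE U X : Ad U X = U *m X *m U^t*.
Proof. exact: lfunE. Qed.

(* <e_j, X e_j> = X j j and |e_j><e_j| = delta_mx j j. *)
Definition dephasing_fun (X : M) : M := \sum_j X j j *: delta_mx j j.

Fact dephasing_fun_is_linear : linear dephasing_fun.
Proof.
move=> a X Y; rewrite /dephasing_fun scaler_sumr -big_split /=.
by apply: eq_bigr => j _; rewrite !mxE scalerDl scalerA.
Qed.

HB.instance Definition _ :=
  GRing.isLinear.Build C M M *:%R dephasing_fun dephasing_fun_is_linear.

Definition dephasing : 'End(M) := linfun dephasing_fun.

Lemma dephasingE X : dephasing X = \sum_j X j j *: delta_mx j j.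
Proof. exact: lfunE. Qed.

Definition twisted_dephasing (U V : M) : 'End(M) :=
  (Ad U \o dephasing \o Ad (V^t*))%VF.

Definition mixed_twisted_dephasing (f : 'End(M)) : Prop :=
  exists (n : nat) (w : 'I_n -> R) (U V : 'I_n -> M),
    [/\ forall i, 0 <= w i,
        \sum_i w i = 1,
        forall i, U i \is unitarymx,
        forall i, V i \is unitarymx
      & f = \sum_i (w i)%:C%C *: twisted_dephasing (U i) (V i)].

End Superoperators.

Arguments depolarizing {R} d.

(* Nonnegativity follows: 0 = N (x - x) <= N x + N x. *)
Definition is_norm (R : realType) (V : lmodType R[i]) (N : V -> R) : Prop :=
  [/\ forall x y, N (x + y) <= N x + N y,
      forall (a : R[i]) x, N (a *: x) = ComplexField.Normc.normc a * N x
    & forall x, N x = 0 -> x = 0].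

(* Main.v *)
(* Write T_{A,B} for X |-> Tr(A X) B, so that delta_d = T_{1,1} / d and
   beta_{U,V} = sum_j T_{v_j v_j^*, u_j u_j^*} in terms of the columns of U, V.
   In the cone generated by the beta's, T_{1,1} is the sum of the beta_{U P, V}
   over the cyclic permutations P; hence T_{1,1} - beta_{U,V} lies in the cone,
   and so every real combination f of beta's is dominated: K T_{1,1} +- f is in
   the cone for some K.  Permuting the columns of U by s and by s composed with
   the transposition (j k), the difference of the two beta's is
   T_{p_j - p_k, q_{s j} - q_{s k}}; by the spectral theorem, T_{A,B} is
   therefore dominated for all traceless Hermitian A, B.  For a unital channel
   tau, tau - delta_d is a combination of finitely many fixed such T_{A,B}, with
   coefficients that are real (by positivity of tau) and bounded by the norm, so
   tau is in the cone once it is close to delta_d.  The weights then sum to 1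
   because tau is unital. *)
From HB Require Import structures.
Require Import Defs.
From mathcomp Require Import all_boot all_order all_fingroup all_algebra.
From mathcomp Require Import reals.
From mathcomp Require Import complex.
From mathcomp Require Import ring.
From mathcomp Require Import boolp classical_sets topology normedtype derive.

Local Set Implicit Arguments.
Local Unset Strict Implicit.
Local Unset Printing Implicit Defensive.

Import Order.TTheory GRing.Theory Num.Theory.
Import numFieldNormedType.Exports.

Local Open Scope ring_scope.

(** * Comparison of norms in finite dimension *)

(** By the triangle inequality [f] is Lipschitz for the sup norm, hence continuous. On the compact
    unit sphere it attains a positive minimum, whose inverse serves as [K]. *)
Lemma rV_norm_bound (R : realType) (n : nat) (f : 'rV[R]_n -> R) :
  (forall x y, f (x + y) <= f x + f y) ->
  (forall a x, f (a *: x) = `|a| * f x) ->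
  (forall x, f x = 0 -> x = 0) ->
  exists2 K : R, 0 < K & forall x, `|x| <= K * f x.
Proof.
move=> fD fZ f_eq0.
have f0 : f 0 = 0 by rewrite -(scale0r 0) fZ normr0 mul0r.
have fN x : f (- x) = f x by rewrite -scaleN1r fZ normrN normr1 mul1r.
have f_ge0 x : 0 <= f x.
  by have := fD x (- x); rewrite subrr f0 fN -mulr2n pmulrn_lge0.
pose L := \sum_(k < n) f (delta_mx 0 k).
have f_le x : f x <= L * `|x|.
  rewrite {1}[x]row_sum_delta.
  apply: (@le_trans _ _ (\sum_(k < n) f (x 0 k *: delta_mx 0 k))).
    apply: (big_ind2 (fun u v => f u <= v)) => [|u v u' v' uv uv'|//].
      by rewrite f0.
    exact: le_trans (fD _ _) (lerD uv uv').
  rewrite mulr_suml; apply: ler_sum => k _; rewrite fZ mulrC ler_wpM2l//.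
  rewrite [leRHS]/Num.Def.normr /= mx_normrE.
  by rewrite (le_bigmax _ (fun ij : 'I_1 * 'I_n => `|x ij.1 ij.2|) (0, k)).
have L_ge0 : 0 <= L by exact: sumr_ge0.
have f_lip x y : `|f x - f y| <= L * `|x - y|.
  rewrite ler_norml lerBlDl lerNl opprB lerBlDl.
  rewrite !(le_trans _ (lerD (lexx _) (f_le _)))//.
    by rewrite -{1}[x](subrK y) addrC fD.
  rewrite -(fN (x - y)) opprB.
  by rewrite -{1}[y](subrK x) addrC fD.
have f_cont : continuous f.
  move=> x; apply/(@cvgrPdist_lt _ _ _ _ (nbhs_filter x)) => e e_gt0.
  (* The Lipschitz constant [L] may vanish, so the division uses [L + 1]. *)
  have L1_gt0 : 0 < L + 1 by rewrite ltr_wpDl.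
  near=> y; rewrite (le_lt_trans (f_lip _ _))//.
  apply: (@le_lt_trans _ _ ((L + 1) * `|x - y|)).
    by rewrite ler_wpM2r// lerDl.
  rewrite mulrC -ltr_pdivlMr//; near: y.
  by apply: cvgr_dist_lt => //; rewrite divr_gt0.
pose S := [set x : 'rV[R]_n | `|x| = 1]%classic.
have S_compact : compact S.
  apply: bounded_closed_compact.
    exists 1; split=> // M M_gt1 x /= ->; exact: ltW.
  apply: (@closed_comp _ _ (fun x : 'rV[R]_n => `|x|) [set 1]%classic).
    by move=> x _; exact: norm_continuous.
  exact: closed_eq.
(* The extreme value theorem needs a point of the sphere; the sphere is empty only when the space is
   zero. *)
have [S0|/nonemptyPn S_empty] := pselect (S !=set0)%classic; last first.
  exists 1 => // x; rewrite mul1r.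
  have [->|x0] := eqVneq x 0; first by rewrite normr0 f0.
  have : S (`|x|^-1 *: x) by rewrite /S /= normrZ normfV normr_id mulVf ?normr_eq0.
  by rewrite S_empty.
have [|c cS c_min] := EVT_min_rV S0 S_compact (f := f).
  exact: continuous_subspaceT.
have fc_gt0 : 0 < f c.
  rewrite lt_neqAle f_ge0 andbT eq_sym; apply/eqP => /f_eq0 c0.
  by move: cS; rewrite inE /S /= c0 normr0 => /eqP; rewrite eq_sym oner_eq0.
exists (f c)^-1; first by rewrite invr_gt0.
move=> x; have [->|x0] := eqVneq x 0; first by rewrite normr0 f0 mulr0.
have nx_gt0 : 0 < `|x| by rewrite normr_gt0.
have := c_min (`|x|^-1 *: x).
rewrite inE /S /= normrZ normfV normr_id mulVf ?normr_eq0// => /(_ erefl).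
by rewrite fZ normfV normr_id ler_pdivlMl// mulrC ler_pdivlMl// mulrC.
Unshelve. all: by end_near.
Qed.

Lemma normc_le_ReIm (R : rcfType) (z : R[i]) :
  Normc.normc z <= `|complex.Re z| + `|complex.Im z|.
Proof.
rewrite [in leLHS](complexE z) (le_trans (le_normcD _ _))//.
rewrite Normc.normcM /= !expr0n /= !addr0 add0r expr1n sqrtr1.
by rewrite mul1r !sqrtr_sqr.
Qed.

Import VectorInternalTheory.

(** Real and imaginary parts of coordinates identify [V] with a real space, where [rV_norm_bound]
    bounds every coordinate by [N]; [l] is then controlled by its values on a basis. *)
Lemma linear_norm_bound (R : realType) (V : vectType R[i]) (N : V -> R)
    (l : {scalar V}) :
  is_norm N ->
  exists2 K : R, 0 < K &
    forall v, Normc.normc (l v) <= K * N v.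
Proof.
move=> [ND NZ N_eq0]; set n := dim V.
(* The first half of [x] holds the real parts of the coordinates, the second half the imaginary
   parts. *)
pose Psi (x : 'rV[R]_(n + n)) : V :=
  @r2v _ V (\row_j (x 0 (lshift n j) +i* x 0 (rshift n j))%C).
have [x y|a x|x|K K_gt0 KN] := @rV_norm_bound R (n + n) (N \o Psi).
- rewrite (le_trans _ (ND _ _))// -linearD /=.
  rewrite le_eqVlt; apply/orP; left; apply/eqP; congr (N (@r2v _ V _)).
  by apply/rowP => j; rewrite !mxE.
- rewrite /= -[in RHS]sqrtr_sqr.
  have -> : Psi (a *: x) = (a%:C)%C *: Psi x.
    rewrite /Psi -linearZ /=; congr r2v; apply/rowP => j; rewrite !mxE.
    by apply/eqP; rewrite eq_complex /= !mul0r subr0 addr0 !eqxx.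
  by rewrite NZ /= expr0n addr0.
- move=> /N_eq0 /(congr1 v2r); rewrite r2vK linear0 => /rowP x0.
  apply/rowP => k; rewrite mxE; case: (splitP k) => j kj.
    by have := congr1 (@complex.Re R) (x0 j); rewrite !mxE /=;
      congr (x _ _ = _); exact: val_inj.
  by have := congr1 (@complex.Im R) (x0 j); rewrite !mxE /=;
      congr (x _ _ = _); exact: val_inj.
pose nl := \sum_j Normc.normc (l (@r2v _ V (delta_mx 0 j))).
have nc_ge0 (z : R[i]) : 0 <= Normc.normc z.
  by case: z => a b; exact: sqrtr_ge0.
have nl_ge0 : 0 <= nl by apply: sumr_ge0.
(* The 2 accounts for real and imaginary parts; the 1 keeps the constant positive when [l]
   vanishes. *)
exists (2 * nl * K + 1) => [|v].
  by rewrite ltr_wpDl// mulr_ge0 ?mulr_ge0 ?(ltW K_gt0).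
pose x : 'rV[R]_(n + n) :=
  row_mx (map_mx (@complex.Re R) (v2r v)) (map_mx (@complex.Im R) (v2r v)).
have Psi_x : Psi x = v.
  rewrite -[RHS]v2rK; congr r2v; apply/rowP => j; rewrite mxE.
  by rewrite row_mxEl row_mxEr 2!mxE; case: (v2r v 0 j).
have x_le k : `|x 0 k| <= K * N v.
  rewrite -Psi_x (le_trans _ (KN x))//.
  rewrite [leRHS]/Num.Def.normr /= mx_normrE.
  by rewrite (le_bigmax _ (fun ij : 'I_1 * 'I_(n + n) => `|x ij.1 ij.2|) (0, k)).
have N_ge0 : 0 <= N v.
  by rewrite -(pmulr_rge0 _ K_gt0) -Psi_x (le_trans _ (KN x)).
have {1}-> : v = \sum_j v2r v 0 j *: @r2v _ V (delta_mx 0 j).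
  rewrite -{1}(v2rK v) {1}(row_sum_delta (v2r v)) linear_sum.
  by apply: eq_bigr => j _; rewrite linearZ.
rewrite linear_sum (@le_trans _ _ (2 * nl * K * N v))//; last first.
  by rewrite [leRHS]mulrDl mul1r lerDl.
apply: (@le_trans _ _ (\sum_j Normc.normc (l (v2r v 0 j *: @r2v _ V (delta_mx 0 j))))).
  apply: (big_ind2 (fun u w => Normc.normc u <= w)) => [|u w u' w' uw uw'|//].
    by rewrite Normc.normc0.
  exact: le_trans (le_normcD _ _) (lerD uw uw').
rewrite -mulrA [2 * nl]mulrC -mulrA mulr_suml; apply: ler_sum => j _.
rewrite linearZ /= Normc.normcM mulrC ler_wpM2l//.
rewrite (le_trans (normc_le_ReIm _))// mulr_natl mulr2n.
by rewrite lerD//; [have := x_le (lshift n j) | have := x_le (rshift n j)];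
  rewrite ?row_mxEl ?row_mxEr mxE.
Qed.

(** * Convex cones *)

Section ConvexCone.
Variables (R : rcfType) (V : lmodType R[i]) (cone : V -> Prop) (J : V).
Hypothesis cone0 : cone 0.
Hypothesis coneD : forall f g, cone f -> cone g -> cone (f + g).
Hypothesis coneZ : forall (a : R) f, 0 <= a -> cone f -> cone (a%:C%C *: f).

(** In the preorder defined by the cone, [f] lies between [- K J] and [K J]. The sign of [K] is left
    free. *)
Definition dominated (f : V) : Prop :=
  exists K : R, cone (K%:C%C *: J + f) /\ cone (K%:C%C *: J - f).

Lemma dominated0 : dominated 0.
Proof. by exists 0; rewrite scale0r subrr addr0. Qed.

Lemma dominatedD f g : dominated f -> dominated g -> dominated (f + g).
Proof.
move=> [K [Kf Kf']] [L [Lg Lg']]; exists (K + L).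
rewrite rmorphD scalerDl; split; last rewrite opprD.
  by rewrite addrACA; exact: coneD.
by rewrite addrACA; exact: coneD.
Qed.

Lemma dominatedN f : dominated f -> dominated (- f).
Proof. by move=> [K [Kf Kf']]; exists K; rewrite opprK. Qed.

Lemma dominatedZ (a : R) f : dominated f -> dominated (a%:C%C *: f).
Proof.
wlog a0 : a f / 0 <= a => [hw|[K [Kf Kf']]].
  have [a0|a0 /dominatedN] := leP 0 a; first exact: hw.
  rewrite -[a]opprK rmorphN scaleNr -scalerN /=; apply: hw.
  by rewrite oppr_ge0 ltW.
exists (a * K); rewrite rmorphM -scalerA -scalerDr -scalerBr.
by split; exact: coneZ.
Qed.

Lemma dominated_sum (I : finType) (f : I -> V) :
  (forall i, dominated (f i)) -> dominated (\sum_i f i).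
Proof.
by move=> df; apply: big_ind => //; [exact: dominated0|exact: dominatedD].
Qed.

(** [J] is split into one share [e * |K i|] for each [g i], large enough to absorb the perturbation
    along [g i], and a nonnegative remainder. *)
Lemma dominated_neighborhood (I : finType) (g : I -> V) :
  cone J -> (forall i, dominated (g i)) ->
  exists2 e : R, 0 < e & forall c : I -> R,
    (forall i, `|c i| <= e) -> cone (J + \sum_i (c i)%:C%C *: g i).
Proof.
move=> cJ /fin_all_exists[K gK]; pose S := \sum_i `|K i|.
have S1_gt0 : 0 < 1 + S by rewrite ltr_wpDr // sumr_ge0.
(* This choice gives [e * S <= 1], so the remainder [1 - e * S] is nonnegative. *)
exists (1 + S)^-1 => [|c c_le]; first by rewrite invr_gt0.
set e := (1 + S)^-1 in c_le *.
have -> : J + \sum_i (c i)%:C%C *: g i = (1 - e * S)%:C%C *: J +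
    \sum_i ((e * `|K i|)%:C%C *: J + (c i)%:C%C *: g i).
  rewrite big_split /= -scaler_suml addrA -scalerDl; congr (_ + _).
  by rewrite -rmorph_sum /= -mulr_sumr -rmorphD /= subrK scale1r.
apply: coneD.
  apply: coneZ => //; rewrite subr_ge0 /e ler_pdivrMl // mulr1.
  by rewrite lerDr ler01.
apply: big_ind => // i _.
(* According to the sign of [c i], the last bracket is one of the two cone members supplied by
   domination. The surplus of [J] is nonnegative because [|c i| <= e] and [K i <= |K i|]. *)
have -> : (e * `|K i|)%:C%C *: J + (c i)%:C%C *: g i =
    (e * `|K i| - `|c i| * K i)%:C%C *: J +
    (`|c i|)%:C%C *: ((K i)%:C%C *: J + (Num.sg (c i))%:C%C *: g i).
  rewrite scalerDr !scalerA addrA -scalerDl -!rmorphM -rmorphD /= subrK.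
  by rewrite [_ * Num.sg _]mulrC -numEsg.
have c_ge0 := normr_ge0 (c i); have Kp := ler_norm (K i).
apply: coneD.
  apply: coneZ => //; rewrite subr_ge0.
  by rewrite (le_trans (ler_wpM2l _ Kp)) // ler_wpM2r.
have [gp gn] := gK i.
case: sgrP => c0; first by rewrite scale0r.
  by apply: coneZ; rewrite ?ltW // scale1r.
by apply: coneZ; rewrite ?oppr_ge0 ?ltW // rmorphN1 scaleN1r.
Qed.

End ConvexCone.

Local Open Scope sesquilinear_scope.

(** * Trace forms, frames and Hermitian matrices *)

Section TraceForms.
Variables (C : numClosedFieldType) (d : nat).
Local Notation M := 'M[C]_d.
Implicit Types (U V A B X Y : M) (f g : 'End(M)).

Definition trace_form_fun (A B X : M) : M := \tr (A *m X) *: B.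

Fact trace_form_fun_is_linear A B : linear (trace_form_fun A B).
Proof.
move=> a X Y; rewrite /trace_form_fun mulmxDr -scalemxAr mxtraceD mxtraceZ.
by rewrite scalerDl scalerA.
Qed.

HB.instance Definition _ A B :=
  GRing.isLinear.Build C M M *:%R (trace_form_fun A B)
    (trace_form_fun_is_linear A B).

Definition trace_form (A B : M) : 'End(M) := linfun (trace_form_fun A B).

Lemma trace_formE A B X : trace_form A B X = \tr (A *m X) *: B.
Proof. exact: lfunE. Qed.

Lemma trace_form_suml (I : finType) (a : I -> C) (A : I -> M) B :
  trace_form (\sum_i a i *: A i) B = \sum_i a i *: trace_form (A i) B.
Proof.
apply/lfunP => X; rewrite sum_lfunE trace_formE mulmx_suml raddf_sum scaler_suml.
apply: eq_bigr => i _.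
by rewrite scale_lfunE trace_formE -scalemxAl /= mxtraceZ scalerA.
Qed.

Lemma trace_form_sumr (I : finType) (b : I -> C) A (B : I -> M) :
  trace_form A (\sum_i b i *: B i) = \sum_i b i *: trace_form A (B i).
Proof.
apply/lfunP => X; rewrite sum_lfunE trace_formE scaler_sumr.
apply: eq_bigr => i _.
by rewrite scale_lfunE trace_formE !scalerA mulrC.
Qed.

Lemma trace_form0l B : trace_form 0 B = 0.
Proof.
by apply/lfunP => X; rewrite zero_lfunE trace_formE mul0mx mxtrace0 scale0r.
Qed.

Lemma trace_form0r A : trace_form A 0 = 0.
Proof. by apply/lfunP => X; rewrite zero_lfunE trace_formE scaler0. Qed.

Lemma trace_formBl A A' B :
  trace_form (A - A') B = trace_form A B - trace_form A' B.
Proof.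
apply/lfunP => X; rewrite add_lfunE opp_lfunE !trace_formE.
by rewrite mulmxBl raddfB scalerBl.
Qed.

Lemma trace_formBr A B B' :
  trace_form A (B - B') = trace_form A B - trace_form A B'.
Proof.
by apply/lfunP => X; rewrite add_lfunE opp_lfunE !trace_formE scalerBr.
Qed.

Lemma trace_formNr A B : trace_form A (- B) = - trace_form A B.
Proof. by rewrite -sub0r trace_formBr trace_form0r sub0r. Qed.

(** Only the terms at [j] and [k] survive; their second factors are opposite, so the sum factors. *)
Lemma trace_form_swap (A B : 'I_d -> M) j k : j != k ->
  \sum_i trace_form (A i) (B i) - \sum_i trace_form (A i) (B (tperm j k i)) =
  trace_form (A j - A k) (B j - B k).
Proof.
move=> jk; rewrite -sumrB; under eq_bigr do rewrite -trace_formBr.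
rewrite (bigD1 j) //= (bigD1 k) /= 1?eq_sym // big1 => [|i /andP[ij ik]].
  by rewrite tpermL tpermR addr0 trace_formBl -(opprB (B j)) trace_formNr.
by rewrite tpermD 1?eq_sym // subrr trace_form0r.
Qed.

(** For unitary [U], the rank-one projection onto column [j] of [U]. *)
Definition frame_proj (U : M) (j : 'I_d) : M := U *m delta_mx j j *m U^t*.

Lemma mxtrace_delta_mul (Y : M) i j : \tr (delta_mx i j *m Y) = Y j i.
Proof.
rewrite /mxtrace (bigD1 i) //= big1 ?addr0 => [|k ki].
  rewrite mxE (bigD1 j) //= big1 ?addr0 => [|k kj]; rewrite !mxE ?eqxx ?mul1r//.
  by rewrite (negPf kj) andbF mul0r.
by rewrite mxE big1 // => l _; rewrite mxE (negPf ki) mul0r.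
Qed.

Lemma mxtrace_frame_proj U j (Y : M) :
  \tr (frame_proj U j *m Y) = (U^t* *m Y *m U) j j.
Proof.
by rewrite /frame_proj -!mulmxA mxtrace_mulC -!mulmxA mxtrace_delta_mul !mulmxA.
Qed.

Lemma sum_frame_proj U : U \is unitarymx -> \sum_j frame_proj U j = 1%:M.
Proof.
move=> /unitarymxP UU; rewrite -mulmx_suml -mulmx_sumr -mx1_sum_delta.
by rewrite mulmx1.
Qed.

(** The inverse makes column [j] of the result equal to column [s j] of [U]. *)
Definition permute_frame U (s : {perm 'I_d}) : M := U *m perm_mx s^-1.

Lemma frame_proj_permute U (s : {perm 'I_d}) j :
  frame_proj (permute_frame U s) j = frame_proj U (s j).
Proof.
rewrite /frame_proj trmx_mul map_mxM tr_perm_mx map_perm_mx invgK.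
rewrite !mulmxA; congr (_ *m _); rewrite -!mulmxA; congr (_ *m _).
rewrite -row_permE -[s in perm_mx s]invgK -col_permE.
apply/matrixP => k l; rewrite !mxE.
by rewrite !(canF_eq (permK _)) !invgK.
Qed.

Lemma unitarymx_permute U s :
  U \is unitarymx -> permute_frame U s \is unitarymx.
Proof.
move=> Uu; apply: mul_unitarymx => //; apply/unitarymxP.
by rewrite tr_perm_mx map_perm_mx -perm_mxM mulgV perm_mx1.
Qed.

Lemma permute_frame1 U : permute_frame U 1 = U.
Proof. by rewrite /permute_frame invg1 perm_mx1 mulmx1. Qed.

Lemma mxtrace_frame_proj1 V j : V \is unitarymx -> \tr (frame_proj V j) = 1.
Proof.
move=> uV; rewrite -[frame_proj V j]mulmx1 mxtrace_frame_proj mulmx1.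
have /unitarymxP : V^t* \is unitarymx by rewrite trmxC_unitary.
by rewrite trmxCK => ->; rewrite mxE eqxx.
Qed.

Lemma hermsymmx_frame A : A \is hermsymmx ->
  exists V (a : 'I_d -> C), [/\ V \is unitarymx,
    forall j, a j \is Num.real & A = \sum_j a j *: frame_proj V j].
Proof.
move=> hA; have /orthomx_spectralP eA := hermitian_normalmx hA.
(* [spectralmx] stands to the right of the diagonal matrix, so the eigenvectors are the columns of
   its adjoint. *)
exists ((spectralmx A)^t*), (spectral_diag A 0); split=> [|j|].
- by rewrite trmxC_unitary spectral_unitarymx.
- by have /mxOverP := hermitian_spectral_diag_real hA; apply.
rewrite {1}eA invmx_unitary ?spectral_unitarymx // diag_mx_sum_delta.
rewrite mulmx_sumr mulmx_suml; apply: eq_bigr => j _.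
by rewrite /frame_proj trmxCK -scalemxAr -scalemxAl.
Qed.

(** The eigenvalues sum to zero, so subtracting the fixed projection [k] from every term changes
    nothing. *)
Lemma traceless_hermsymmx_frame A k : A \is hermsymmx -> \tr A = 0 ->
  exists V (a : 'I_d -> C), [/\ V \is unitarymx,
    forall j, a j \is Num.real &
    A = \sum_j a j *: (frame_proj V j - frame_proj V k)].
Proof.
move=> /hermsymmx_frame[V [a [uV ra ->]]] trA; exists V, a; split=> //.
under [RHS]eq_bigr do rewrite scalerBr.
rewrite sumrB -scaler_suml [X in X *: _](_ : _ = 0) ?scale0r ?subr0 //.
rewrite -[RHS]trA raddf_sum; apply: eq_bigr => j _.
by rewrite /= mxtraceZ mxtrace_frame_proj1 // mulr1.
Qed.

End TraceForms.

(** * A Hermitian tight frame and the traceless part *)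

Section HermitianFrame.
Variables (C : numClosedFieldType) (d' : nat).
Local Notation d := d'.+1.
Local Notation M := 'M[C]_d.
Implicit Types (A B X : M) (f g : 'End(M)).

Lemma hermsymmxE A : (A \is hermsymmx) = (A == A^t*).
Proof. by rewrite qualifE /= expr0 scale1r. Qed.

(** A redundant family indexed by all ordered pairs: the repetitions over [(i, j)] and [(j, i)] and
    the zero matrices at [i = j] allow an expansion with uniform weights. *)
Definition herm_frame (m : 'I_d * 'I_d * bool) : M :=
  if m.2 then 'i *: (delta_mx m.1.1 m.1.2 - delta_mx m.1.2 m.1.1)
  else delta_mx m.1.1 m.1.2 + delta_mx m.1.2 m.1.1.

Lemma herm_frame_hermsym m : herm_frame m \is hermsymmx.
Proof.
case: m => [[i j] []]; rewrite hermsymmxE /herm_frame /=; apply/eqP.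
  rewrite linearZ /= map_mxZ /= conjCi scaleNr -scalerN [(_ - _)^T]linearB /=.
  rewrite map_mxB opprB.
  by rewrite !trmx_delta !map_delta_mx.
by rewrite raddfD /= map_mxD !trmx_delta !map_delta_mx addrC.
Qed.

(* [herm_frame] is a tight frame for the Hilbert-Schmidt inner product. *)
Lemma herm_frame_expansion X :
  X = 4^-1 *: \sum_m \tr (herm_frame m *m X) *: herm_frame m.
Proof.
have n4 : (4 : C) != 0 by rewrite pnatr_eq0.
apply: (scalerI n4); rewrite scalerA divff // scale1r.
(* For each pair the two values of the boolean together contribute [2 X_ij E_ij + 2 X_ji E_ji], and
   each half sums to [2 X]. *)
transitivity (\sum_(p : 'I_d * 'I_d)
    (2 * X p.1 p.2) *: delta_mx p.1 p.2 +
    \sum_(p : 'I_d * 'I_d) (2 * X p.2 p.1) *: delta_mx p.2 p.1 : M).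
  have eX : \sum_(p : 'I_d * 'I_d) (2 * X p.1 p.2) *: delta_mx p.1 p.2 = 2 *: X.
    rewrite [X in RHS]matrix_sum_delta pair_big scaler_sumr.
    by apply: eq_bigr => p _; rewrite scalerA.
  have sw : bijective (fun p : 'I_d * 'I_d => (p.2, p.1)).
    by exists (fun p : 'I_d * 'I_d => (p.2, p.1)) => -[].
  have eX' : \sum_(p : 'I_d * 'I_d) (2 * X p.2 p.1) *: delta_mx p.2 p.1 = 2 *: X.
    by rewrite -eX [RHS](reindex _ (onW_bij _ sw)).
  by rewrite eX eX' -scalerDl -natrD.
rewrite -big_split /= -(pair_bigA _ (fun p b =>
  \tr (herm_frame (p, b) *m X) *: herm_frame (p, b))) /=.
apply: eq_bigr => -[i j] _; rewrite big_bool /herm_frame /=.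
rewrite -scalemxAl mxtraceZ mulmxBl mulmxDl mxtraceD raddfB /= !mxtrace_delta_mul.
rewrite scalerA mulrAC -expr2 sqrCi.
by apply/matrixP => k l; rewrite !mxE; ring.
Qed.

Definition traceless_part_fun (X : M) : M := X - (\tr X / d%:R)%:M.

Fact traceless_part_fun_is_linear : linear traceless_part_fun.
Proof.
move=> a X Y; rewrite /traceless_part_fun mxtraceD mxtraceZ mulrDl -mulrA.
by rewrite scalerBr raddfD /= scale_scalar_mx opprD addrACA.
Qed.

HB.instance Definition _ :=
  GRing.isLinear.Build C M M *:%R traceless_part_fun
    traceless_part_fun_is_linear.

Local Notation Q := traceless_part_fun.

Lemma mxtrace_traceless_part X : \tr (Q X) = 0.
Proof.
rewrite raddfB /= mxtrace_scalar -[(_ / _) *+ _]mulr_natr divfK ?subrr //.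
by rewrite pnatr_eq0.
Qed.

Lemma hermsymmx_mxtrace_real A : A \is hermsymmx -> \tr A \is Num.real.
Proof.
rewrite hermsymmxE => /eqP hA; apply/CrealP.
by rewrite /mxtrace rmorph_sum; apply: eq_bigr => i _; rewrite [in RHS]hA !mxE.
Qed.

Lemma traceless_part_hermsym A : A \is hermsymmx -> Q A \is hermsymmx.
Proof.
move=> hA; have tA := hermsymmx_mxtrace_real hA.
rewrite hermsymmxE raddfB /= map_mxB tr_scalar_mx map_scalar_mx.
move: hA; rewrite hermsymmxE => /eqP <- /=; rewrite (CrealP _) //.
by rewrite realM ?realV ?realn.
Qed.

(** Self-adjointness of [Q] for the trace pairing; it moves [Q] from the argument of a map onto the
    frame matrices. *)
Lemma mxtrace_mul_traceless_part A X : \tr (A *m Q X) = \tr (Q A *m X).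
Proof.
rewrite mulmxBr mulmxBl !raddfB /= mul_scalar_mx mul_mx_scalar !mxtraceZ.
by rewrite mulrAC [_ * \tr A]mulrC mulrAC.
Qed.

(** The hypotheses give [f = Q f Q]. Expanding both argument and value in the tight frame costs a
    factor 1/4 each, hence 1/16. *)
Lemma traceless_map_expansion f :
  (forall X, \tr (f X) = 0) -> f 1%:M = 0 ->
  f = \sum_m \sum_n (16^-1 * \tr (herm_frame n *m f (herm_frame m))) *:
        trace_form (Q (herm_frame m)) (Q (herm_frame n)).
Proof.
move=> trf f1.
have fQ X : f (Q X) = f X.
  by rewrite /Q raddfB /= -scalemx1 linearZ /= f1 scaler0 subr0.
have Qf X : Q (f X) = f X by rewrite /Q trf mul0r raddf0 subr0.
have Qexp Y : Q Y = 4^-1 *: \sum_m \tr (herm_frame m *m Y) *: Q (herm_frame m).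
  rewrite [Y in LHS]herm_frame_expansion linearZ linear_sum /=.
  by congr (_ *: _); apply: eq_bigr => m _; rewrite linearZ.
have fexp Y :
    f Y = 4^-1 *: \sum_m \tr (Q (herm_frame m) *m Y) *: f (herm_frame m).
  rewrite -fQ [Q Y]herm_frame_expansion linearZ linear_sum /=; congr (_ *: _).
  by apply: eq_bigr => m _; rewrite linearZ /= mxtrace_mul_traceless_part.
apply/lfunP => Y; rewrite sum_lfunE fexp scaler_sumr.
apply: eq_bigr => m _; rewrite sum_lfunE -{1}Qf (Qexp (f _)) !scaler_sumr.
apply: eq_bigr => n _; rewrite scale_lfunE trace_formE !scalerA.
by congr (_ *: _); field; rewrite ?pnatr_eq0.
Qed.

End HermitianFrame.
(** * The cone of twisted dephasing channels *)

Section TwistedDephasingCone.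
Variables (R : realType) (d : nat).
Local Notation C := (R[i]).
Local Notation M := 'M[C]_d.
Implicit Types (U V A B X Y : M) (f g : 'End(M)).

(** The channel measures in the basis of columns of [V] and prepares the matching column of [U]. *)
Lemma twisted_dephasingE U V :
  twisted_dephasing U V =
  \sum_j trace_form (frame_proj V j) (frame_proj U j).
Proof.
apply/lfunP => X; rewrite sum_lfunE !comp_lfunE !AdE dephasingE.
rewrite mulmx_sumr mulmx_suml; apply: eq_bigr => j _.
by rewrite trace_formE mxtrace_frame_proj trmxCK -scalemxAr -scalemxAl.
Qed.

(** [mixed_twisted_dephasing] without the normalization of the weights. *)
Definition td_cone (f : 'End(M)) : Prop :=
  exists (n : nat) (w : 'I_n -> R) (U V : 'I_n -> M),
    [/\ forall i, 0 <= w i,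
        forall i, U i \is unitarymx,
        forall i, V i \is unitarymx
      & f = \sum_i (w i)%:C%C *: twisted_dephasing (U i) (V i)].

Lemma td_cone0 : td_cone 0.
Proof.
exists 0, (fun=> 0), (fun=> 0), (fun=> 0); split=> [//|[]//|[]//|].
by rewrite big_ord0.
Qed.

Lemma td_coneD f g : td_cone f -> td_cone g -> td_cone (f + g).
Proof.
move=> [m [w [U [V [w0 uU uV ->]]]]] [n [x [W [Y [x0 uW uY ->]]]]].
pose glue T (a : 'I_m -> T) (b : 'I_n -> T) i :=
  match split i with inl j => a j | inr k => b k end.
exists (m + n)%N, (glue _ w x), (glue _ U W), (glue _ V Y).
split=> [i|i|i|]; rewrite ?/glue; try by case: split.
rewrite big_split_ord /= /glue; apply: f_equal2; apply: eq_bigr => i _.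
  by rewrite (unsplitK (inl i)).
by rewrite (unsplitK (inr i)).
Qed.

Lemma td_coneZ (a : R) f : 0 <= a -> td_cone f -> td_cone (a%:C%C *: f).
Proof.
move=> a0 [n [w [U [V [w0 uU uV ->]]]]].
exists n, (fun i => a * w i), U, V; split=> // [i|]; first exact: mulr_ge0.
by rewrite scaler_sumr; apply: eq_bigr => i _; rewrite scalerA rmorphM.
Qed.

Lemma td_cone_td U V :
  U \is unitarymx -> V \is unitarymx -> td_cone (twisted_dephasing U V).
Proof.
move=> uU uV; exists 1, (fun=> 1), (fun=> U), (fun=> V); split=> //.
by rewrite big_ord1 scale1r.
Qed.

Lemma td_cone_sum (I : finType) (P : pred I) (f : I -> 'End(M)) :
  (forall i, P i -> td_cone (f i)) -> td_cone (\sum_(i | P i) f i).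
Proof. by move=> cf; apply: big_ind => //; [exact: td_cone0|exact: td_coneD]. Qed.

Definition td_dominated f :=
  dominated (@td_cone) (trace_form 1%:M 1%:M) f.

Lemma td_dominated0 : td_dominated 0.
Proof. exact: dominated0 td_cone0. Qed.

Lemma td_dominatedD f g :
  td_dominated f -> td_dominated g -> td_dominated (f + g).
Proof. exact: dominatedD td_coneD _ _. Qed.

Lemma td_dominatedB f g :
  td_dominated f -> td_dominated g -> td_dominated (f - g).
Proof. by move=> df /dominatedN; exact: td_dominatedD. Qed.

Lemma td_dominatedZ (a : C) f :
  a \is Num.real -> td_dominated f -> td_dominated (a *: f).
Proof. by move=> /RRe_real <-; exact: dominatedZ td_coneZ _ _. Qed.

Lemma td_dominated_sum (I : finType) (f : I -> 'End(M)) :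
  (forall i, td_dominated (f i)) -> td_dominated (\sum_i f i).
Proof. exact: dominated_sum td_cone0 td_coneD _ _. Qed.

End TwistedDephasingCone.

(** * Domination of trace forms of traceless Hermitian matrices *)

Section HermitianTensors.
Variables (R : realType) (d' : nat).
Local Notation d := d'.+1.
Local Notation C := (R[i]).
Local Notation M := 'M[C]_d.
Implicit Types U V A B : M.

(** For each fixed [j], the cyclic sum [s + j] runs over all indices as [s] does, so every
    projection of [V] is paired with the identity. *)
Lemma trace_form1_shifts U V : U \is unitarymx -> V \is unitarymx ->
  trace_form 1%:M 1%:M =
  \sum_(s : 'I_d) twisted_dephasing (permute_frame U (perm (addrI s))) V.
Proof.
move=> uU uV; under eq_bigr do rewrite twisted_dephasingE.
rewrite exchange_big /=.
under eq_bigr => j _ do under eq_bigr do rewrite frame_proj_permute permE.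
transitivity (\sum_j trace_form (frame_proj V j) 1%:M).
  rewrite -{1}(sum_frame_proj uV).
  under eq_bigr do rewrite -[frame_proj _ _]scale1r.
  by rewrite trace_form_suml; apply: eq_bigr => j _; rewrite scale1r.
apply: eq_bigr => j _.
rewrite -{1}(sum_frame_proj uU) (reindex_inj (addIr j)).
under eq_bigr do rewrite -[frame_proj _ _]scale1r.
by rewrite trace_form_sumr; apply: eq_bigr => s _; rewrite scale1r.
Qed.

Lemma td_cone_trace_form1 : td_cone (trace_form 1%:M 1%:M : 'End(M)).
Proof.
have u1 : (1%:M : M) \is unitarymx.
  by apply/unitarymxP; rewrite trmx1 map_mx1 mulmx1.
rewrite (trace_form1_shifts u1 u1); apply: td_cone_sum => s _.
by apply: td_cone_td; [exact (unitarymx_permute _ u1)|exact u1].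
Qed.

(** The shift by 0 is the identity, so the channel is itself a term of [trace_form1_shifts] and
    [K = 1] suffices. *)
Lemma td_dominated_td U V :
  U \is unitarymx -> V \is unitarymx -> td_dominated (twisted_dephasing U V).
Proof.
move=> uU uV; exists 1; rewrite scale1r.
have c s : td_cone (twisted_dephasing (permute_frame U (perm (addrI s))) V).
  by apply: td_cone_td; [exact (unitarymx_permute _ uU)|exact uV].
rewrite (trace_form1_shifts uU uV); split.
  by apply: td_coneD; [exact: td_cone_sum|exact: td_cone_td].
rewrite (bigD1 0) //=.
have -> : perm (addrI (0 : 'I_d)) = 1%g.
  by apply/permP => j; rewrite permE perm1 add0r.
by rewrite permute_frame1 addrAC subrr add0r; apply: td_cone_sum.
Qed.

Lemma td_dominated_frame_diff U V (s : {perm 'I_d}) j k :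
  U \is unitarymx -> V \is unitarymx ->
  td_dominated (trace_form (frame_proj V j - frame_proj V k)
                        (frame_proj U (s j) - frame_proj U (s k))).
Proof.
move=> uU uV; have [->|jk] := eqVneq j k.
  by rewrite subrr trace_form0l; exact: td_dominated0.
(* In [tperm j k * s] the transposition acts first, so the images of [j] and [k] under [s] are
   exchanged. *)
rewrite (_ : trace_form _ _ = twisted_dephasing (permute_frame U s) V -
   twisted_dephasing (permute_frame U (tperm j k * s)) V).
  apply: td_dominatedB; apply: td_dominated_td.
  - exact (unitarymx_permute _ uU).
  - exact uV.
  - exact (unitarymx_permute _ uU).
  - exact uV.
rewrite !twisted_dephasingE -(trace_form_swap _ (fun i => frame_proj U (s i)) jk).
apply: f_equal2; last apply: (f_equal -%R).
  by apply: eq_bigr => i _; rewrite frame_proj_permute.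
by apply: eq_bigr => i _; rewrite frame_proj_permute permM.
Qed.

Lemma td_dominated_trace_form A B :
  A \is hermsymmx -> B \is hermsymmx -> \tr A = 0 -> \tr B = 0 ->
  td_dominated (trace_form A B).
Proof.
move=> hA hB /(traceless_hermsymmx_frame 0 hA)[V [a [uV ra ->]]].
move=> /(traceless_hermsymmx_frame 0 hB)[U [b [uU rb ->]]].
rewrite trace_form_suml; apply: td_dominated_sum => j.
apply: td_dominatedZ; first exact: ra.
rewrite trace_form_sumr; apply: td_dominated_sum => k.
apply: td_dominatedZ; first exact: rb.
have [->|j0] := eqVneq j 0.
  by rewrite subrr trace_form0l; exact: td_dominated0.
have [->|k0] := eqVneq k 0.
  by rewrite [X in trace_form _ X]subrr trace_form0r; exact: td_dominated0.
(* This permutation sends [j] to [k] and fixes 0, since both indices are nonzero. *)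
have := td_dominated_frame_diff (tperm j k) j 0 uU uV.
by rewrite tpermL tpermD // eq_sym.
Qed.

End HermitianTensors.

(** * Channels near the depolarizing channel *)

Section Positivity.
Variables (C : numClosedFieldType) (d : nat).

(** Isometry identifying dimension [d] with the one-block dimension [\sum_(i < 1) d], a
    syntactically different index. *)
Definition single_block_mx : 'M[C]_(\sum_(i < 1) d, d) := \mxcol_i 1%:M.

Lemma single_block_mxC : single_block_mx^t* = \mxrow_(i < 1) 1%:M.
Proof. by rewrite tr_mxcol; apply/matrixP => i j; rewrite !mxE conjC_nat eq_sym. Qed.

Lemma mxblock1E (X : 'M[C]_d) :
  \mxblock_(i < 1, j < 1) X = single_block_mx *m X *m single_block_mx^t*.
Proof.
rewrite single_block_mxC mxcol_mul mul_mxcol_mxrow; apply: eq_mxblock => i j.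
by rewrite mul1mx mulmx1.
Qed.

Lemma single_block_mxK : single_block_mx^t* *m single_block_mx = 1%:M.
Proof. by rewrite single_block_mxC mul_mxrow_mxcol big_ord1 mulmx1. Qed.

(** The value is the squared modulus of coordinate [j] of [V^t* *m v]. *)
Lemma frame_proj_psd (V : 'M[C]_d) j (v : 'cV[C]_d) :
  0 <= (v^t* *m frame_proj V j *m v) 0 0.
Proof.
have -> : (v^t* *m frame_proj V j *m v) 0 0 =
    \tr (frame_proj V j *m (v *m v^t*)).
  by rewrite mulmxA mxtrace_mulC -mulmxA /mxtrace big_ord1.
rewrite mxtrace_frame_proj mulmxA -mulmxA mxE big_ord1.
have -> : v^t* *m V = (V^t* *m v)^t* by rewrite trmx_mul map_mxM trmxCK.
by rewrite [(_^t*) _ _]mxE [(_^T) _ _]mxE -normCK exprn_ge0.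
Qed.

Lemma mxtrace_frame_proj_col (U Y : 'M[C]_d) k :
  \tr (frame_proj U k *m Y) = ((col k U)^t* *m Y *m col k U) 0 0.
Proof.
rewrite mxtrace_frame_proj.
have -> : (col k U)^t* = row k (U^t*) by apply/matrixP => i j; rewrite !mxE.
by rewrite -row_mul colE mulmxA -colE [RHS]mxE -row_mul [RHS]mxE.
Qed.

End Positivity.

(** Complete positivity at [n = 1], transported along [single_block_mx]. *)
Lemma cp_psdmx (R : realType) d (f : 'End('M[R[i]]_d)) X :
  completely_positive f -> psdmx X -> psdmx (f X).
Proof.
move=> fcp X_psd; have fX_psd := fcp 1 (\mxblock_(i < 1, j < 1) X) _.
have {}/fX_psd fX_psd : psdmx (\mxblock_(i < 1, j < 1) X).
  move=> v; rewrite mxblock1E.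
  have := X_psd (single_block_mx _ _ ^t* *m v).
  by rewrite trmx_mul map_mxM trmxCK !mulmxA.
move=> v; have := fX_psd (single_block_mx _ _ *m v).
rewrite /ampliation; under eq_mxblock do rewrite mxblockK.
rewrite mxblock1E trmx_mul map_mxM !mulmxA.
rewrite -(mulmxA _ _ (single_block_mx _ _)) single_block_mxK mulmx1.
by rewrite -(mulmxA _ _ (single_block_mx _ _)) single_block_mxK mulmx1.
Qed.

Lemma cp_mxtrace_real (R : realType) d (f : 'End('M[R[i]]_d)) A B :
  completely_positive f -> A \is hermsymmx -> B \is hermsymmx ->
  \tr (B *m f A) \is Num.real.
Proof.
move=> fcp /hermsymmx_frame[V [a [uV ra ->]]] /hermsymmx_frame[U [b [uU rb ->]]].
rewrite mulmx_suml raddf_sum; apply: rpred_sum => k _ /=.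
rewrite -scalemxAl mxtraceZ; apply: realM; first exact: rb.
rewrite linear_sum mulmx_sumr raddf_sum; apply: rpred_sum => j _ /=.
rewrite linearZ -scalemxAr mxtraceZ; apply: realM; first exact: ra.
apply: ger0_real; rewrite mxtrace_frame_proj_col.
by apply: (cp_psdmx fcp) => v; exact: frame_proj_psd.
Qed.

(** Every twisted dephasing channel is unital, so evaluation at the identity gives the sum of the
    weights. *)
Lemma td_cone_mixed (R : realType) (d' : nat) (f : 'End('M[R[i]]_d'.+1)) :
  td_cone f -> unital f -> mixed_twisted_dephasing f.
Proof.
move=> [n [w [U [V [w0 uU uV ef]]]]] f1.
exists n, w, U, V; split=> //; apply: (@complexI R).
have td1 i : twisted_dephasing (U i) (V i) 1%:M = 1%:M.
  rewrite twisted_dephasingE sum_lfunE -[RHS](sum_frame_proj (uU i)).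
  apply: eq_bigr => j _.
  by rewrite trace_formE mulmx1 mxtrace_frame_proj1 ?scale1r.
move: f1; rewrite /unital ef sum_lfunE.
under eq_bigr do rewrite scale_lfunE td1.
rewrite -scaler_suml scalemx1 => /matrixP/(_ 0 0).
by rewrite !mxE eqxx !mulr1n rmorph_sum.
Qed.

Lemma trace_form_depolarizing (R : realType) (d' : nat) :
  trace_form 1%:M 1%:M = d'.+1%:R *: depolarizing d'.+1
    :> 'End('M[R[i]]_d'.+1).
Proof.
apply/lfunP => X; rewrite scale_lfunE trace_formE depolarizingE mul1mx.
rewrite -[in RHS]scalemx1 scalerA mulrC divfK //.
by rewrite pnatr_eq0.
Qed.

(** * Expansion of a unital channel around the depolarizing channel *)

Section FrameCoefficients.
Variables (R : realType) (d' : nat).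
Local Notation C := (R[i]).
Local Notation M := 'M[C]_d'.+1.

(** The coefficient in [traceless_map_expansion], as a linear functional of [f] to which
    [linear_norm_bound] applies. *)
Definition frame_coef (A B : M) (f : 'End(M)) : C := 16^-1 * \tr (B *m f A).

Fact frame_coef_is_scalar A B : scalar (frame_coef A B).
Proof.
move=> a f g; rewrite /frame_coef add_lfunE scale_lfunE mulmxDr mxtraceD.
by rewrite -scalemxAr mxtraceZ mulrDr mulrCA.
Qed.

HB.instance Definition _ A B :=
  GRing.isLinear.Build C 'End(M) C *%R (frame_coef A B)
    (frame_coef_is_scalar A B).

Lemma depolarizing_trace_preserving : trace_preserving (@depolarizing R d'.+1).
Proof.
move=> X; rewrite depolarizingE mxtrace_scalar -[(_ / _) *+ _]mulr_natr divfK //.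
by rewrite pnatr_eq0.
Qed.

Lemma depolarizing_unital : unital (@depolarizing R d'.+1).
Proof. by rewrite /unital depolarizingE mxtrace1 divff // pnatr_eq0. Qed.

Lemma frame_coef_real (tau : 'End(M)) (A B : M) :
  completely_positive tau -> A \is hermsymmx -> B \is hermsymmx ->
  frame_coef A B (tau - depolarizing d'.+1) \is Num.real.
Proof.
move=> tau_cp hA hB; apply: realM; first by rewrite realV realn.
rewrite add_lfunE opp_lfunE mulmxBr raddfB /=.
apply: realB; first exact: cp_mxtrace_real.
rewrite depolarizingE mul_mx_scalar mxtraceZ.
apply: realM; last exact (hermsymmx_mxtrace_real hB).
apply: realM; first exact (hermsymmx_mxtrace_real hA).
by rewrite realV realn.
Qed.

Local Notation H := (@herm_frame C d').

(** Both channels are unital and trace preserving, so their difference kills the identity and has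
    traceless values. Factoring out the inverse dimension puts the sum in the form of
    [dominated_neighborhood]. *)
Lemma channel_expansion (tau : 'End(M)) :
  quantum_channel tau -> unital tau ->
  tau = ((d'.+1%:R^-1 : R)%:C)%C *: (trace_form 1%:M 1%:M +
    \sum_p (d'.+1%:R * complex.Re (frame_coef (H p.1) (H p.2)
                                     (tau - depolarizing d'.+1)))%:C%C *:
      trace_form (traceless_part_fun (H p.1)) (traceless_part_fun (H p.2))).
Proof.
move=> [tau_cp tau_tp] tau1; set f := tau - depolarizing d'.+1.
have n0 : (d'.+1%:R : C) != 0 by rewrite pnatr_eq0.
have f_tr X : \tr (f X) = 0.
  rewrite /f add_lfunE opp_lfunE raddfB /= tau_tp depolarizing_trace_preserving.
  by rewrite subrr.
have f1 : f 1%:M = 0.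
  by rewrite /f add_lfunE opp_lfunE tau1 depolarizing_unital subrr.
have ef : f = \sum_p frame_coef (H p.1) (H p.2) f *:
    trace_form (traceless_part_fun (H p.1)) (traceless_part_fun (H p.2)).
  by rewrite [LHS](traceless_map_expansion f_tr f1) pair_big.
rewrite fmorphV rmorph_nat; apply: (scalerI n0).
rewrite scalerA divff // scale1r trace_form_depolarizing.
rewrite -[tau in LHS](subrK (depolarizing d'.+1)) -/f addrC scalerDr.
apply: f_equal2; first by [].
rewrite [in LHS]ef scaler_sumr; apply: eq_bigr => p _.
rewrite rmorphM rmorph_nat /= RRe_real ?scalerA //.
by apply: frame_coef_real => //; exact: herm_frame_hermsym.
Qed.

End FrameCoefficients.

Theorem theorem4p7 (R : realType) (d : nat) (d_gt0 : (0 < d)%N)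
    (N : 'End('M[R[i]]_d) -> R) (normN : is_norm N) :
  exists eps : R, 0 < eps /\
    forall tau : 'End('M[R[i]]_d),
      quantum_channel tau -> unital tau ->
      N (tau - depolarizing d) < eps ->
      mixed_twisted_dephasing tau.
Proof.
case: d d_gt0 N normN => // d' _ N normN.
pose I := (('I_d'.+1 * 'I_d'.+1 * bool) * ('I_d'.+1 * 'I_d'.+1 * bool))%type.
pose H := @herm_frame R[i] d'.
pose g (p : I) :=
  trace_form (traceless_part_fun (H p.1)) (traceless_part_fun (H p.2)).
have [|p|e e_gt0 e_cone] := @dominated_neighborhood R _ _
  (trace_form 1%:M 1%:M) (@td_cone0 _ _) (@td_coneD _ _) (@td_coneZ _ _) I g.
- exact: td_cone_trace_form1.
- apply: td_dominated_trace_form;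
    by [exact/traceless_part_hermsym/herm_frame_hermsym
       |exact: mxtrace_traceless_part].
have /fin_all_exists2[K K_gt0 K_le] : forall p : I, exists2 K : R, 0 < K &
    forall f, Normc.normc (frame_coef (H p.1) (H p.2) f) <= K * N f.
  by move=> p; exact: linear_norm_bound.
pose S := 1 + \sum_p K p.
have K_le_S p : K p <= S.
  rewrite /S (bigD1 p) //= addrCA lerDl addr_ge0 // sumr_ge0 // => q _.
  exact: ltW.
have S_gt0 : 0 < S by rewrite ltr_wpDr // sumr_ge0 // => p _; exact: ltW.
have d_gt0 : 0 < d'.+1%:R :> R by rewrite ltr0n.
(* Each coefficient in [channel_expansion] is at most the dimension times [S] times the norm of the
   difference, so this bound keeps it below [e]. *)
exists (e / (d'.+1%:R * S)); split; first by rewrite divr_gt0 ?mulr_gt0.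
move=> tau tau_ch tau1; rewrite ltr_pdivlMr ?mulr_gt0 // => N_lt.
apply: td_cone_mixed => //; rewrite (channel_expansion tau_ch tau1).
apply: td_coneZ; first by rewrite invr_ge0 ltW.
apply: e_cone => p; rewrite (le_trans _ (ltW N_lt)) //.
rewrite normrM (ger0_norm (ltW d_gt0)) mulrCA ler_wpM2l ?(ltW d_gt0) // mulrC.
have N_ge0 : 0 <= N (tau - depolarizing d'.+1).
  rewrite -(pmulr_rge0 _ (K_gt0 p)); apply: le_trans (K_le p _).
  by case: frame_coef => a b; exact: sqrtr_ge0.
rewrite (le_trans _ (ler_wpM2r N_ge0 (K_le_S p))) // (le_trans _ (K_le p _)) //.
by rewrite -lecR; exact: normc_ge_Re.
Qed.
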